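(* Let $\varrho(N)$ be probability measures on $\hat U(N)$, $N\in\mathbb{N}$, such that $m_{N,PP(0)}[\varrho(N)]$ converges as $N\to\infty$ in probability, in the sense of moments, to a deterministic measure $\mu^{(0)}$ with moments $(\mu^{(0)}_k)_{k\ge0}$. Then for every $q\in[-1,1]$, $m_{N,PP(q)}[\varrho(N)]$ converges in probability, in the sense of moments, to a deterministic probability measure $\mu^{(q)}$ whose moments $(\mu^{(q)}_k)$ satisfy the identity of formal power series \[ \exp\Big(-q\sum_{k\ge0}\mu^{(0)}_kz^{k+1}\Big)=1-q\sum_{k\ge0}\mu^{(q)}_kz^{k+1}. \]
   Context: A signature of length $N$ is a tuple $\lambda=(\lambda_1\ge\dots\ge\lambda_N)\in\mathbb{Z}^N$; $\hat U(N)$ denotes the set of signatures of length $N$. For $q\in[-1,1]$ and $\lambda\in\hat U(N)$ the $q$-deformed Perelomov–Popov measure is \[ m_{N,PP(q)}[\lambda]=\frac1N\sum_{i=1}^N\Big(\prod_{j\ne i}\frac{(\lambda_i-i)-(\lambda_j-j)-q}{(\lambda_i-i)-(\lambda_j-j)}\Big)\delta\Big(\frac{\lambda_i+N-i}{N}\Big), \] and $m_{N,PP(q)}[\varrho(N)]$ denotes the random measure $m_{N,PP(q)}[\lambda]$ with $\lambda$ distributed according to $\varrho(N)$. Random measures $m_N$ converge in probability in the sense of moments to a deterministic measure $\mu$ if for every $k$, $\int t^k m_N(dt)\to\int t^k\mu(dt)$ in probability. *)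

(* Defs.v *)
From HB Require Import structures.
From mathcomp Require Import all_boot all_order all_algebra.
From mathcomp Require Import all_classical all_reals all_analysis.
Set Implicit Arguments. Unset Strict Implicit. Unset Printing Implicit Defensive.
Import Order.TTheory GRing.Theory Num.Theory.
Import numFieldNormedType.Exports.
Local Open Scope classical_set_scope.
Local Open Scope ring_scope.

(* A length-N integer tuple, indexed by 'I_N; paper index i (1-based) is
   ordinal i' with i = i'.+1. *)
Definition is_signature (N : nat) (l : {ffun 'I_N -> int}) : Prop :=
  forall i j : 'I_N, (i <= j)%N -> l j <= l i.

Definition shifted (R : realType) (N : nat) (l : {ffun 'I_N -> int}) (i : 'I_N) : R :=
  (l i)%:~R - (i.+1)%:R.

Definition PP_weight (R : realType) (N : nat) (q : R) (l : {ffun 'I_N -> int}) (i : 'I_N) : R :=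
  \prod_(j < N | j != i)
     ((shifted R l i - shifted R l j - q) / (shifted R l i - shifted R l j)).

Definition PP_point (R : realType) (N : nat) (l : {ffun 'I_N -> int}) (i : 'I_N) : R :=
  ((l i)%:~R + N%:R - (i.+1)%:R) / N%:R.

Definition PP_moment (R : realType) (N : nat) (q : R) (l : {ffun 'I_N -> int}) (k : nat) : R :=
  N%:R^-1 * \sum_(i < N) PP_weight q l i * PP_point R l i ^+ k.

Definition prob_weights (R : realType) (N : nat) (rho : {ffun 'I_N -> int} -> R) : Prop :=
  [/\ (forall l, 0 <= rho l),
      (forall l, ~ is_signature l -> rho l = 0) &
      (\esum_(l in [set: {ffun 'I_N -> int}]) (rho l)%:E = 1%E)].

Definition prob_of (R : realType) (N : nat) (rho : {ffun 'I_N -> int} -> R)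
  (A : set {ffun 'I_N -> int}) : \bar R :=
  \esum_(l in A) (rho l)%:E.

Definition moments_cvg_in_prob (R : realType) (rho : forall N : nat, {ffun 'I_N -> int} -> R)
  (q : R) (mu : nat -> R) : Prop :=
  forall (k : nat) (eps : R), 0 < eps ->
    (fun N : nat => prob_of (rho N) [set l | eps < `|PP_moment q l k - mu k| ])
      @ \oo --> (0 : \bar R).

Definition fps_mul (R : realType) (f g : nat -> R) : nat -> R :=
  fun n => \sum_(i < n.+1) f i * g (n - i)%N.

Definition fps_pow (R : realType) (f : nat -> R) (n : nat) : nat -> R :=
  iter n (fps_mul f) (fun m => (m == 0%N)%:R).

(* exp(f) for a series f with zero constant term: sum_n f^n / n! *)
Definition fps_exp (R : realType) (f : nat -> R) : nat -> R :=
  fun m => \sum_(n < m.+1) fps_pow f n m / (n`!)%:R.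

(* Main.v *)
(** For a fixed signature with points [x_i = (lambda_i + N - i) / N], partial
    fractions show that the moments of the PP(q) measure are the coefficients of
    [prod_i (1 - (x_i + q/N) z) / (1 - x_i z) = 1 - q sum_k M_k^(q) z^(k+1)].
    The logarithmic derivative of this product is a power series whose
    coefficients are [j q M_(j-1)^(0)] up to corrections of order [1/N], so
    [M_k^(q)] satisfies, in the limit, the recursion that characterises
    [exp (- q sum_k mu_k^(0) z^(k+1))], and convergence in probability follows
    by induction on [k].

    It remains to realise the limits as the moments of a probability measure.
    For [|q| <= 1] the PP(q) weights are nonnegative, so the limits are limits of
    moments of finitely supported probability measures. Their quantile functions
    on ]0, 1[ are nondecreasing and pointwise bounded by the second moments; by
    Tychonoff they have a pointwise cluster point [f], a subsequence converges to
    [f] at the rationals, hence at the continuity points of [f], hence almost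
    everywhere. The higher moments give a domination by [t^(-1/2) + (1-t)^(-1/2)],
    so all moments pass to the limit, and the image of the uniform law by [f] is
    the required measure. *)
Require Import Defs.
From HB Require Import structures.
From mathcomp Require Import all_boot all_order all_algebra.
From mathcomp Require Import all_classical all_reals all_analysis.
From mathcomp Require Import measurable_realfun.
From mathcomp Require Import ring lra zify.
Set Implicit Arguments. Unset Strict Implicit. Unset Printing Implicit Defensive.
Import Order.TTheory GRing.Theory Num.Theory.
Import numFieldNormedType.Exports.
Local Open Scope classical_set_scope.
Local Open Scope ring_scope.

(** * Formal power series: ring laws, Euler derivation, exponential *)

Section FormalPowerSeries.
Variable R : realType.
Implicit Types f g h : nat -> R.

(* The Euler derivation [z d/dz], which needs no index shift. *)
Definition fps_deriv f : nat -> R := fun n => n%:R * f n.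

(** A coefficient depends only on truncations, so commutativity and associativity of the Cauchy
    product can be imported from polynomials. *)
Lemma fps_mul_coefM f g (K n : nat) : (n < K)%N ->
  fps_mul f g n = ((\poly_(i < K) f i) * (\poly_(i < K) g i))`_n.
Proof.
move=> nK; rewrite coefM; apply: eq_bigr => i _.
by rewrite !coef_poly (leq_ltn_trans (leq_subr _ _) nK) (leq_trans (ltn_ord i) nK).
Qed.

Lemma fps_mulC f g : fps_mul f g = fps_mul g f.
Proof.
by apply/funext => n; rewrite !(@fps_mul_coefM _ _ n.+1)// mulrC.
Qed.

Lemma coef_poly_fps_mul f g (K n : nat) : (n < K)%N ->
  (\poly_(i < K) fps_mul f g i)`_n = ((\poly_(i < K) f i) * (\poly_(i < K) g i))`_n.
Proof. by move=> nK; rewrite coef_poly nK; exact: fps_mul_coefM. Qed.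

Lemma fps_mulA f g h : fps_mul f (fps_mul g h) = fps_mul (fps_mul f g) h.
Proof.
apply/funext => n; rewrite (@fps_mul_coefM _ _ n.+1)// [RHS](@fps_mul_coefM _ _ n.+1)//.
pose p (f : nat -> R) := \poly_(i < n.+1) f i.
transitivity ((p f * (p g * p h))`_n).
  by rewrite !coefM; apply: eq_bigr => i _; rewrite coef_poly_fps_mul// ltnS leq_subr.
rewrite mulrA !coefM; apply: eq_bigr => i _.
by rewrite coef_poly_fps_mul.
Qed.

Lemma fps_mulDr f g h :
  fps_mul f (fun n => g n + h n) = fun n => fps_mul f g n + fps_mul f h n.
Proof.
by apply/funext => n; rewrite /fps_mul -big_split/=; apply: eq_bigr => i _; rewrite mulrDr.
Qed.

Lemma fps_derivM f g : fps_deriv (fps_mul f g) =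
  fun n => fps_mul (fps_deriv f) g n + fps_mul f (fps_deriv g) n.
Proof.
apply/funext => n; rewrite /fps_deriv /fps_mul mulr_sumr -big_split/=.
apply: eq_bigr => i _.
have -> : n%:R = i%:R + (n - i)%:R :> R by rewrite -natrD subnKC// -ltnS.
by ring.
Qed.

Lemma fps_powS f n : fps_pow f n.+1 = fps_mul f (fps_pow f n).
Proof. by []. Qed.

Lemma fps_deriv_pow f n :
  fps_deriv (fps_pow f n.+1) = fun m => n.+1%:R * fps_mul (fps_deriv f) (fps_pow f n) m.
Proof.
elim: n => [|n IH].
  rewrite fps_powS fps_derivM; apply/funext => m; rewrite mul1r.
  rewrite [X in _ + X](_ : _ = 0) ?addr0//.
  by rewrite /fps_mul big1// => i _; rewrite /fps_deriv /=; case: (_ - _)%N => [|k] /=; ring.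
rewrite fps_powS fps_derivM; apply/funext => m; rewrite IH.
rewrite -[n.+2%:R]natr1 mulrDl mul1r addrC; congr (_ + _).
transitivity (n.+1%:R * fps_mul f (fps_mul (fps_deriv f) (fps_pow f n)) m).
  by rewrite /fps_mul mulr_sumr; apply: eq_bigr => i _; rewrite mulrCA.
by rewrite fps_mulA (fps_mulC f) -fps_mulA.
Qed.

Lemma fps_pow_eq0 f n m : f 0%N = 0 -> (m < n)%N -> fps_pow f n m = 0.
Proof.
move=> f0; elim: n m => // n IH m mn; rewrite fps_powS /fps_mul big1// => i _.
have [->|i0] := posnP i; first by rewrite f0 mul0r.
by rewrite IH ?mulr0//; have := ltn_ord i; lia.
Qed.

Lemma fps_exp0 f : fps_exp f 0 = 1.
Proof. by rewrite /fps_exp big_ord_recl big_ord0 /= fact0 divr1 addr0. Qed.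

(** The power [f^n] has order at least [n], so the terms added beyond [n = m] vanish. A common bound
    [K] for several coefficients is what permits exchanging sums in [fps_deriv_exp]. *)
Lemma fps_exp_big f m K : f 0%N = 0 -> (m < K)%N ->
  fps_exp f m = \sum_(n < K) fps_pow f n m / (n`!)%:R.
Proof.
move=> f0 mK; rewrite /fps_exp (big_ord_widen _ (fun n => fps_pow f n m / (n`!)%:R) mK).
rewrite big_mkcond/=; apply: eq_bigr => i _; case: ifPn => //.
by rewrite -leqNgt => /(fps_pow_eq0 f0) ->; rewrite mul0r.
Qed.

(** With the constant term 1, this differential equation determines the exponential recursively; it
    is the form in which the exponential is compared with the finite products. *)
Lemma fps_deriv_exp f : f 0%N = 0 ->
  fps_deriv (fps_exp f) = fps_mul (fps_deriv f) (fps_exp f).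
Proof.
move=> f0; apply/funext => m.
rewrite {1}/fps_deriv (@fps_exp_big _ _ m.+2)// mulr_sumr big_ord_recl/=.
transitivity (\sum_(n < m.+1) fps_mul (fps_deriv f) (fps_pow f n) m / (n`!)%:R).
  rewrite fact0 mulrA [X in X + _](_ : _ = 0); last by case: m => [|m] /=; rewrite ?mul0r// mulr0 mul0r.
  rewrite add0r; apply: eq_bigr => i _.
  have := congr1 (fun F => F m) (fps_deriv_pow f i); rewrite /fps_deriv.
  rewrite /bump/= add1n mulrA => ->.
  rewrite factS natrM; field.
  by rewrite addrC natr1 !pnatr_eq0 -lt0n fact_gt0.
rewrite /fps_mul (eq_bigr (fun n : 'I_m.+1 => \sum_(i < m.+1)
    fps_deriv f i * (fps_pow f n (m - i)%N / (n`!)%:R))); last first.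
  by move=> n _; rewrite mulr_suml; apply: eq_bigr => i _; rewrite mulrA.
rewrite exchange_big/=; apply: eq_bigr => i _; rewrite -mulr_sumr.
by rewrite -(@fps_exp_big _ _ m.+1)// ltnS leq_subr.
Qed.

End FormalPowerSeries.

(** * Partial fractions and logarithmic derivative of a finite product *)

Section PartialFractions.
Variables (R : realType) (I : eqType) (x : I -> R) (e : R).
Implicit Types r : seq I.

(** The residue at [u = x_i] of [prod_j (u - x_j - e) / (u - x_j)]. *)
Definition residue r (i : I) : R :=
  - e * \prod_(j <- r | j != i) ((x i - x j - e) / (x i - x j)).

(** The expansion of the same product in [z = 1/u], that is, of
    [prod_j (1 - (x_j + e) z) / (1 - x_j z)], read off from its partial fractions. *)
Definition residue_series r : nat -> R :=
  fun n => if n is k.+1 then \sum_(i <- r) residue r i * x i ^+ k else 1.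

Definition shift_power_diff r : nat -> R :=
  fun n => \sum_(i <- r) ((x i + e) ^+ n - x i ^+ n).

Lemma residue_cons r i j : j \notin r -> i \in r ->
  residue (j :: r) i = residue r i * ((x i - x j - e) / (x i - x j)).
Proof.
move=> jr ir; rewrite /residue big_cons ifT; first by ring.
by apply: contraNneq jr => ->.
Qed.

Lemma residue_cons_head r j : j \notin r ->
  residue (j :: r) j = - e * \prod_(i <- r) ((x j - x i - e) / (x j - x i)).
Proof.
move=> jr; rewrite /residue big_cons eqxx/=; congr (_ * _).
rewrite big_seq_cond [RHS]big_seq; apply: eq_bigl => i.
by case: (boolP (i \in r)) => //= ir; apply: contraNneq jr => <-.
Qed.

(** Induction on the nodes. The hypothesis is used at [u] and also at the new node [x_j], where it
    evaluates the new residue. *)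
Lemma partial_fractions r u : uniq (map x r) -> u \notin map x r ->
  \prod_(i <- r) ((u - x i - e) / (u - x i)) = 1 + \sum_(i <- r) residue r i / (u - x i).
Proof.
elim: r u => [|j r IH] u; first by rewrite !big_nil addr0.
rewrite /= inE negb_or => /andP[xjr ur] /andP[uj unr].
have jr : j \notin r by apply: contra xjr; exact: map_f.
rewrite !big_cons IH// residue_cons_head// IH//.
have ujN : u - x j != 0 by rewrite subr_eq0.
rewrite [X in _ = _ + (_ + X)](eq_big_seq (fun i => residue r i / (u - x i) * ((u - x j - e) / (u - x j))
    + e / (u - x j) * (residue r i / (x j - x i)))); last first.
  move=> i ir; rewrite residue_cons//.
  have uiN : u - x i != 0.
    by rewrite subr_eq0; apply: contraNneq unr => ->; exact: map_f.
  have ijN : x i - x j != 0.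
    by rewrite subr_eq0; apply: contraNneq xjr => <-; exact: map_f.
  have jiN : x j - x i != 0 by rewrite -opprB oppr_eq0.
  by field; rewrite uiN ijN ujN jiN.
rewrite big_split/= -mulr_suml -mulr_sumr.
by field.
Qed.

Lemma residue_series1 j : residue_series [:: j] = fun n => if n is k.+1 then - e * x j ^+ k else 1.
Proof.
apply/funext => -[//|k] /=; rewrite big_cons big_nil addr0 /residue.
by rewrite big_cons eqxx/= big_nil mulr1.
Qed.

(** Since the series is defined through residues, its multiplicativity has to be proved:
    [partial_fractions] at [x_j] rewrites the new residue, and the convolution of powers of [x_i]
    and [x_j] is a finite geometric sum. *)
Lemma residue_series_cons j r : uniq (map x (j :: r)) ->
  residue_series (j :: r) = fps_mul (residue_series r) (residue_series [:: j]).
Proof.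
rewrite /= => /andP[xjr ur].
have jr : j \notin r by apply: contra xjr; exact: map_f.
apply/funext => -[|k].
  by rewrite /fps_mul big_ord_recl big_ord0 /= mulr1 addr0.
rewrite residue_series1 /fps_mul big_ord_recl/= ?subn0 mul1r big_cons.
rewrite big_ord_recr/= /bump/= add1n subnn mulr1.
rewrite residue_cons_head// partial_fractions//.
rewrite (eq_bigr (fun a : 'I_k => \sum_(i <- r)
    residue r i * (- e * (x i ^+ a * x j ^+ (k.-1 - a))))); last first.
  move=> a _; rewrite add1n -[(k.+1 - a.+1)%N]/(k - a)%N.
  have -> : (k - a)%N = (k.-1 - a).+1 by have := ltn_ord a; lia.
  by rewrite mulr_suml; apply: eq_bigr => i _; ring.
rewrite exchange_big/= mulrDr mulr1 mulrDl -addrA; congr (_ + _).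
rewrite mulr_sumr mulr_suml -!big_split/=; apply: eq_big_seq => i ir.
have ijN : x i - x j != 0.
  by rewrite subr_eq0; apply: contraNneq xjr => <-; exact: map_f.
have jiN : x j - x i != 0 by rewrite -opprB oppr_eq0.
rewrite residue_cons// -mulr_sumr -mulr_sumr.
have geo : (x i - x j) * (\sum_(a < k) x i ^+ a * x j ^+ (k.-1 - a)) = x i ^+ k - x j ^+ k.
  rewrite -opprB -[RHS]opprB mulNr; congr (- _); rewrite subrXX; congr (_ * _).
  by apply: eq_bigr => a _; rewrite mulrC; congr (_ ^+ _ * _); have := ltn_ord a; lia.
have -> : \sum_(a < k) x i ^+ a * x j ^+ (k.-1 - a) = (x i ^+ k - x j ^+ k) / (x i - x j).
  by rewrite -geo; field.
by field; rewrite ijN jiN.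
Qed.

(* Logarithmic derivative of [prod_i (1 - (x_i + e) z) / (1 - x_i z)]. *)
Lemma residue_series_deriv r : uniq (map x r) ->
  fps_deriv (residue_series r) =
  fun n => - fps_mul (shift_power_diff r) (residue_series r) n.
Proof.
(* For one node the product is [1 - e z / (1 - x_j z)], and the identity amounts to factoring [e]
   out of [(x_j + e)^(n+1) - x_j^(n+1)]. *)
have base j : fps_deriv (residue_series [:: j]) =
  fun n => - fps_mul (shift_power_diff [:: j]) (residue_series [:: j]) n.
  apply/funext => -[|n]; rewrite /fps_deriv residue_series1 /fps_mul.
    by rewrite big_ord_recl big_ord0 /shift_power_diff big_cons big_nil !expr0; ring.
  rewrite big_ord_recr/= subnn mulr1 /shift_power_diff big_cons big_nil addr0.
  rewrite (eq_bigr (fun a : 'I_n.+1 => - e * ((x j + e) ^+ a * x j ^+ (n - a)) + e * x j ^+ n)); last first.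
    move=> a _; rewrite big_cons big_nil addr0 (subSn (leq_ord a))/=.
    have -> : x j ^+ n = x j ^+ a * x j ^+ (n - a) by rewrite -exprD subnKC// -ltnS.
    by ring.
  rewrite big_split/= sumr_const card_ord -mulr_sumr.
  have : e * (\sum_(a < n.+1) (x j + e) ^+ a * x j ^+ (n - a)) = (x j + e) ^+ n.+1 - x j ^+ n.+1.
    rewrite -[RHS]opprB subrXX -mulNr opprB [x j + e]addrC addrK; congr (_ * _).
    by apply: eq_bigr => a _; rewrite mulrC; congr (_ ^+ _ * _); rewrite subSS.
  by move=> E; rewrite [- e * \sum_(_ < _) _]mulNr E -[_ *+ n.+1]mulr_natl; ring.
elim: r => [|j r IH] u.
  apply/funext => n; rewrite /fps_mul big1 ?oppr0; last by move=> i _; rewrite /shift_power_diff big_nil mul0r.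
  by rewrite /fps_deriv; case: n => [|n]; rewrite /= ?mul0r// big_nil mulr0.
(* By the Leibniz rule the logarithmic derivatives of the two factors add up. *)
rewrite residue_series_cons// fps_derivM IH; last by case/andP: u.
rewrite base; apply/funext => n.
set f := residue_series r; set g := residue_series [:: j].
set d1 := shift_power_diff r; set d2 := shift_power_diff [:: j].
have -> : shift_power_diff (j :: r) = fun n => d1 n + d2 n.
  by apply/funext => k; rewrite /shift_power_diff big_cons /d2 /shift_power_diff big_cons big_nil addr0 addrC.
have oppl (a b : nat -> R) : fps_mul (fun n => - a n) b n = - fps_mul a b n.
  by rewrite /fps_mul -sumrN; apply: eq_bigr => i _; rewrite mulNr.
rewrite [fps_mul f _]fps_mulC !oppl -opprD; congr (- _).
rewrite [RHS](congr1 (fun F => F n) (fps_mulC _ _)) fps_mulDr.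
by rewrite (fps_mulC _ d1) (fps_mulC _ d2) -!fps_mulA (fps_mulC g f).
Qed.

End PartialFractions.

(** * The PP(q) moments of a fixed signature *)

Section SignaturePoints.
Variables (R : realType) (N : nat) (l : {ffun 'I_N -> int}).
Hypothesis lsig : is_signature l.

Lemma shifted_ltn (i j : 'I_N) : (i < j)%N -> shifted R l j + 1 <= shifted R l i.
Proof.
move=> ij; rewrite /shifted.
have h1 : (l j)%:~R <= (l i)%:~R :> R by rewrite ler_int lsig// ltnW.
have h2 : i.+2%:R <= j.+1%:R :> R by rewrite ler_nat ltnS.
rewrite -[i.+2%:R]natr1 in h2.
by lra.
Qed.

Lemma PP_point_shifted (i : 'I_N) : PP_point R l i = shifted R l i / N%:R + 1.
Proof.
have N0 : N%:R != 0 :> R by rewrite pnatr_eq0 -lt0n (leq_ltn_trans _ (ltn_ord i)).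
by rewrite /PP_point /shifted; field.
Qed.

Lemma PP_point_le (i j : 'I_N) : (i <= j)%N -> PP_point R l j <= PP_point R l i.
Proof.
rewrite leq_eqVlt => /predU1P[/val_inj->//|/shifted_ltn ij].
by rewrite !PP_point_shifted lerD2r ler_wpM2r ?invr_ge0//; lra.
Qed.

Lemma shifted_neq (i j : 'I_N) : i != j -> shifted R l i - shifted R l j != 0.
Proof.
move=> ij; have : (i < j)%N || (j < i)%N by rewrite -neq_ltn.
by case/orP => /shifted_ltn h; rewrite subr_eq0; apply/eqP; lra.
Qed.

Lemma PP_point_inj : injective (PP_point R l).
Proof.
move=> i j; apply: contra_eq => /shifted_neq; rewrite !PP_point_shifted.
have N0 : N%:R != 0 :> R by rewrite pnatr_eq0 -lt0n (leq_ltn_trans _ (ltn_ord i)).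
by apply: contraNneq => /addIr/(mulIf (invr_neq0 N0)) ->; rewrite subrr.
Qed.

(** Distinct shifted coordinates differ by at least [1 >= |q|], so subtracting [q] cannot reverse
    the sign of a difference. *)
Lemma PP_weight_ge0 (q : R) (i : 'I_N) : -1 <= q <= 1 -> 0 <= PP_weight q l i.
Proof.
move=> /andP[q1 q2]; apply: prodr_ge0 => j ji.
have : (i < j)%N || (j < i)%N by rewrite -neq_ltn eq_sym.
case/orP => /shifted_ltn h; first by apply: divr_ge0; lra.
by rewrite -mulrNN -invrN; apply: divr_ge0; lra.
Qed.

Lemma PP_weight0 (i : 'I_N) : PP_weight 0 l i = 1 :> R.
Proof. by apply: big1 => j ji; rewrite subr0 divff// shifted_neq// eq_sym. Qed.

Lemma PP_moment0 k : PP_moment 0 l k = N%:R^-1 * \sum_(i < N) PP_point R l i ^+ k.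
Proof. by rewrite /PP_moment; under eq_bigr do rewrite PP_weight0 mul1r. Qed.

(** The shift is [q / N] because the points are the shifted coordinates divided by [N], up to a
    translation. *)
Definition PP_series (q : R) : nat -> R :=
  residue_series (PP_point R l) (q / N%:R) (index_enum 'I_N).

Lemma PP_seriesS q k : (0 < N)%N -> PP_series q k.+1 = - q * PP_moment q l k.
Proof.
move=> N0; rewrite /PP_series /= /PP_moment mulrA mulr_sumr; apply: eq_bigr => i _.
have N0R : N%:R != 0 :> R by rewrite pnatr_eq0 -lt0n.
rewrite mulrA mulNr; congr (_ * _); rewrite /residue -mulNr; congr (_ * _).
apply: eq_bigr => j ji; rewrite !PP_point_shifted.
have ijN : shifted R l i - shifted R l j != 0 by rewrite shifted_neq// eq_sym.
by field; rewrite N0R ijN.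
Qed.

Lemma PP_series_rec q n : (0 < N)%N -> PP_series q n.+1 =
  - n.+1%:R^-1 * \sum_(j < n.+1)
    (\sum_(m < j.+1) 'C(j.+1, m)%:R * (q * (q / N%:R) ^+ (j - m)) * PP_moment 0 l m)
    * PP_series q (n - j)%N.
Proof.
move=> N0; have N0R : N%:R != 0 :> R by rewrite pnatr_eq0 -lt0n.
have /(congr1 (fun F => F n.+1)) : fps_deriv (PP_series q) =
    fun n => - fps_mul (shift_power_diff (PP_point R l) (q / N%:R) (index_enum 'I_N)) (PP_series q) n.
  by apply: residue_series_deriv; rewrite map_inj_uniq ?index_enum_uniq//; exact: PP_point_inj.
rewrite /fps_deriv /fps_mul big_ord_recl/=.
(* The constant coefficient vanishes, so the right-hand side involves only earlier coefficients of
   [PP_series]. *)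
have -> : shift_power_diff (PP_point R l) (q / N%:R) (index_enum 'I_N) 0 = 0.
  by apply: big1 => i _; rewrite !expr0 subrr.
rewrite mul0r add0r => E.
have n0 : n.+1%:R != 0 :> R by rewrite pnatr_eq0.
apply: (mulfI n0); rewrite E mulrA mulrN divff// mulN1r; congr (- _).
apply: eq_bigr => j _; rewrite /bump/= add1n subSS; congr (_ * _).
rewrite /shift_power_diff.
rewrite (eq_bigr (fun i => \sum_(m < j.+1) 'C(j.+1, m)%:R * (q / N%:R) ^+ (j.+1 - m) * PP_point R l i ^+ m)); last first.
  move=> i _; rewrite [PP_point R l i + _]addrC exprDn big_ord_recr/= binn subnn mulr1n expr0 mul1r addrK.
  by apply: eq_bigr => m _; rewrite -mulr_natl mulrA.
rewrite exchange_big/=; apply: eq_bigr => m _.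
rewrite PP_moment0 -mulr_sumr (subSn (leq_ord m)) exprS.
by field.
Qed.

(** The recursion at [n = 0] shows that the weights average to 1; this makes the PP(q) measure a
    probability measure. *)
Lemma PP_moment_0 (q : R) : (0 < N)%N -> q != 0 -> PP_moment q l 0 = 1.
Proof.
move=> N0 q0; have N0R : N%:R != 0 :> R by rewrite pnatr_eq0 -lt0n.
have := PP_series_rec q 0 N0; rewrite PP_seriesS// !big_ord_recl !big_ord0/=.
rewrite PP_moment0 sumr_const card_ord mulVf// bin0 /PP_series/= => h.
by apply: (mulfI q0); rewrite -[LHS]opprK -mulNr h; field.
Qed.

End SignaturePoints.

(** * Calculus of convergence in probability *)

Section ConvergenceInProbability.
Variables (R : realType) (rho : forall N : nat, {ffun 'I_N -> int} -> R).
Hypothesis rhoP : forall N, prob_weights (@rho N).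
Implicit Types X Y : forall N : nat, {ffun 'I_N -> int} -> R.

Definition cvg_in_prob X (c : R) : Prop := forall eps : R, 0 < eps ->
  (fun N : nat => prob_of (@rho N) [set l | eps < `|X N l - c|]) @ \oo --> (0 : \bar R).

Lemma prob_of_ge0 N A : (0 <= prob_of (@rho N) A)%E.
Proof. by apply: esum_ge0 => l _; case: (rhoP N) => h _ _; rewrite lee_fin. Qed.

(** The union bound. The inclusion is only asked on signatures, as [rho] vanishes elsewhere. *)
Lemma prob_of_leD N (A B C : set {ffun 'I_N -> int}) :
  (forall l, is_signature l -> A l -> B l \/ C l) ->
  (prob_of (@rho N) A <= prob_of (@rho N) B + prob_of (@rho N) C)%E.
Proof.
case: (rhoP N) => rho0 rhoS _ ABC.
rewrite /prob_of esum_mkcond [X in (X + _)%E]esum_mkcond [X in (_ + X)%E]esum_mkcond.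
rewrite -esumD; try by move=> l _; case: ifP; rewrite ?lee_fin.
apply: le_esum => l _.
have [ls|/rhoS ->] := pselect (is_signature l); last by rewrite !if_same adde0.
have [Al|Al] := boolP (l \in A); last by apply: adde_ge0; case: ifP; rewrite ?lee_fin.
move/set_mem/(ABC l ls) : Al => -[] /mem_set ->.
  by rewrite leeDl//; case: ifP; rewrite ?lee_fin.
by rewrite leeDr//; case: ifP; rewrite ?lee_fin.
Qed.

Lemma prob_of_le N (A B : set {ffun 'I_N -> int}) :
  (forall l, is_signature l -> A l -> B l) ->
  (prob_of (@rho N) A <= prob_of (@rho N) B)%E.
Proof.
move=> AB; have := @prob_of_leD N A B set0; rewrite {3}/prob_of esum_set0 adde0.
by apply => l ls Al; left; exact: AB.
Qed.

Lemma prob_of_lt1_ex N (A : set {ffun 'I_N -> int}) :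
  (prob_of (@rho N) A < 1)%E -> exists2 l, is_signature l & ~ A l.
Proof.
move=> A1; apply: contrapT => h; move: A1; apply/negP; rewrite -leNgt.
case: (rhoP N) => _ _ <-; apply: prob_of_le => l ls _.
by apply: contrapT => Al; apply: h; exists l.
Qed.

(** The common pattern of the limit rules below: a deviation of [X] forces one of two events of
    vanishing probability. *)
Lemma cvg_in_prob_squeeze X c (B C : forall eps : R, forall N, set {ffun 'I_N -> int}) :
  (forall eps, 0 < eps -> prob_of (@rho N) (B eps N) @[N --> \oo] --> (0 : \bar R)) ->
  (forall eps, 0 < eps -> prob_of (@rho N) (C eps N) @[N --> \oo] --> (0 : \bar R)) ->
  (forall eps, 0 < eps -> \forall N \near \oo, forall l : {ffun 'I_N -> int},
     is_signature l -> eps < `|X N l - c| -> B eps N l \/ C eps N l) ->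
  cvg_in_prob X c.
Proof.
move=> hB hC h eps e0.
apply: (@squeeze_cvge _ _ _ _ (cst 0%E) _
  (fun N => prob_of (@rho N) (B eps N) + prob_of (@rho N) (C eps N))%E).
- near=> N; rewrite prob_of_ge0/=; apply: prob_of_leD.
  by near: N; exact: h.
- exact: cvg_cst.
- rewrite -[X in _ --> X]adde0; apply: cvgeD => //; [exact: hB|exact: hC].
Unshelve. all: by end_near. Qed.

Lemma prob_of_set0_cvg : prob_of (@rho N) set0 @[N --> \oo] --> (0 : \bar R).
Proof. by rewrite /prob_of; under eq_fun do rewrite esum_set0; exact: cvg_cst. Qed.

Lemma eq_cvg_in_prob X Y c :
  (\forall N \near \oo, forall l : {ffun 'I_N -> int}, is_signature l -> X N l = Y N l) ->
  cvg_in_prob X c -> cvg_in_prob Y c.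
Proof.
move=> XY Xc; apply: (cvg_in_prob_squeeze (C := fun _ _ => set0) Xc) => //.
  by move=> eps _; exact: prob_of_set0_cvg.
by move=> eps e0; apply: filterS XY => N XY l ls; rewrite -XY//; left.
Qed.

Lemma cvg_in_prob_deterministic (u : nat -> R) c :
  u @ \oo --> c -> cvg_in_prob (fun N _ => u N) c.
Proof.
move=> uc; apply: (@cvg_in_prob_squeeze _ _ (fun _ _ => set0) (fun _ _ => set0)).
- by move=> eps _; exact: prob_of_set0_cvg.
- by move=> eps _; exact: prob_of_set0_cvg.
- move=> eps e0; have /cvgrPdist_lt/(_ _ e0) := uc.
  by apply: filterS => N h l _; rewrite distrC => /(lt_trans h); rewrite ltxx.
Qed.

Lemma cvg_in_probD X Y a b : cvg_in_prob X a -> cvg_in_prob Y b ->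
  cvg_in_prob (fun N l => X N l + Y N l) (a + b).
Proof.
move=> Xa Yb; apply: (@cvg_in_prob_squeeze _ _
  (fun eps N => [set l | eps / 2 < `|X N l - a|])
  (fun eps N => [set l | eps / 2 < `|Y N l - b|])).
- by move=> eps e0; apply: Xa; rewrite divr_gt0.
- by move=> eps e0; apply: Yb; rewrite divr_gt0.
- move=> eps e0; apply: nearW => N l _ /=; rewrite opprD addrACA => h.
  have [?|hX] := ltP (eps / 2) `|X N l - a|; [by left|right].
  have := ler_normD (X N l - a) (Y N l - b); lra.
Qed.

Lemma cvg_in_probM X Y a b : cvg_in_prob X a -> cvg_in_prob Y b ->
  cvg_in_prob (fun N l => X N l * Y N l) (a * b).
Proof.
(* If both deviations are at most [d <= 1], their product is at most [d], and the total error is at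
   most [d (1 + |a| + |b|) <= eps]. *)
move=> Xa Yb; pose d (eps : R) := Num.min 1 (eps / (1 + `|a| + `|b|)).
have s0 : 0 < 1 + `|a| + `|b| by rewrite ltr_wpDr// ltr_wpDr.
have d0 eps : 0 < eps -> 0 < d eps by move=> e0; rewrite lt_min ltr01 divr_gt0.
apply: (@cvg_in_prob_squeeze _ _
  (fun eps N => [set l | d eps < `|X N l - a|])
  (fun eps N => [set l | d eps < `|Y N l - b|])).
- by move=> eps e0; apply: Xa; exact: d0.
- by move=> eps e0; apply: Yb; exact: d0.
- move=> eps e0; apply: nearW => N l _ /= h.
  have [?|hX] := ltP (d eps) `|X N l - a|; [by left|right].
  rewrite ltNge; apply/negP => hY; move: h; apply/negP; rewrite -leNgt.
  have -> : X N l * Y N l - a * b =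
    (X N l - a) * (Y N l - b) + (a * (Y N l - b) + b * (X N l - a)) by ring.
  have d1 : d eps <= 1 by rewrite ge_min lexx.
  have d2 : d eps * (1 + `|a| + `|b|) <= eps.
    by rewrite -ler_pdivlMr// ge_min lexx orbT.
  apply: le_trans d2; apply: le_trans (ler_normD _ _) _.
  apply: (@le_trans _ _ (`|X N l - a| * `|Y N l - b| + (`|a| * `|Y N l - b| + `|b| * `|X N l - a|))).
    by rewrite normrM lerD2l (le_trans (ler_normD _ _))// !normrM.
  have : `|X N l - a| * `|Y N l - b| <= 1 * d eps by apply: ler_pM => //; exact: le_trans d1.
  have : `|a| * `|Y N l - b| <= `|a| * d eps by apply: ler_wpM2l.
  have : `|b| * `|X N l - a| <= `|b| * d eps by apply: ler_wpM2l.
  lra.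
Qed.

Lemma cvg_in_prob_cst c : cvg_in_prob (fun _ _ => c) c.
Proof. by apply: cvg_in_prob_deterministic; exact: cvg_cst. Qed.

Lemma cvg_in_prob_sum n (X : 'I_n -> forall N, {ffun 'I_N -> int} -> R) (c : 'I_n -> R) :
  (forall i, cvg_in_prob (X i) (c i)) ->
  cvg_in_prob (fun N l => \sum_(i < n) X i N l) (\sum_(i < n) c i).
Proof.
elim: n X c => [|n IH] X c h.
  rewrite big_ord0; apply: eq_cvg_in_prob (cvg_in_prob_cst 0).
  by apply: nearW => N l _; rewrite big_ord0.
rewrite big_ord_recl; apply: eq_cvg_in_prob (cvg_in_probD (h ord0) (IH _ _ (fun i => h (lift ord0 i)))).
by apply: nearW => N l _; rewrite big_ord_recl.
Qed.

(** An event of probability less than 1 misses some signature; this extracts deterministic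
    signatures from a limit in probability. *)
Lemma cvg_in_prob_ex X c (eps : R) : cvg_in_prob X c -> 0 < eps ->
  \forall N \near \oo, exists2 l : {ffun 'I_N -> int},
    is_signature l & `|X N l - c| <= eps.
Proof.
move=> /[apply] h.
have : \forall N \near \oo, (prob_of (@rho N) [set l | (eps < `|X N l - c|)%R] < 1)%E.
  by apply: (h [set x | (x < 1)%E]); exact: (open_ereal_lt' lte01).
apply: filterS => N /prob_of_lt1_ex[l ls /negP]; rewrite -leNgt => le.
by exists l.
Qed.

End ConvergenceInProbability.

(** * Limits of the PP(q) moments *)

Section LimitMoments.
Variables (R : realType) (rho : forall N : nat, {ffun 'I_N -> int} -> R).
Hypothesis rhoP : forall N, prob_weights (@rho N).
Variables (m0 : nat -> R) (q : R).
Hypothesis cvg0 : moments_cvg_in_prob rho 0 m0.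

Let L : nat -> R := fun n => if n is k.+1 then - q * m0 k else 0.

(** The limit is kept as [0 ^+ p] so that [p = 0], where it equals 1, is covered as well. *)
Lemma cvg_invn_exp (p : nat) : (q / N%:R) ^+ p @[N --> \oo] --> (0 : R) ^+ p.
Proof.
have h : q / N%:R @[N --> \oo] --> (0 : R).
  rewrite -[X in _ --> X](mulr0 q); apply: cvgMr.
  by apply/gtr0_cvgV0 => //; [near=> N; rewrite ltr0n; near: N; exact: nbhs_infty_gt | exact: cvgr_idn].
elim: p => [|p IH]; first by rewrite expr0; under eq_fun do rewrite expr0; exact: cvg_cst.
by rewrite exprS; under eq_fun do rewrite exprS; exact: cvgM.
Unshelve. all: by end_near. Qed.

(** The limiting form of [PP_series_rec], obtained from the differential equation of the
    exponential. *)
Lemma fps_expS_rec n : fps_exp L n.+1 =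
  - n.+1%:R^-1 * \sum_(j < n.+1) (j.+1%:R * (q * m0 j)) * fps_exp L (n - j)%N.
Proof.
have n0 : n.+1%:R != 0 :> R by rewrite pnatr_eq0.
have /(congr1 (fun F => F n.+1)) := @fps_deriv_exp R L erefl.
rewrite /fps_mul {1}/fps_deriv big_ord_recl {1}/fps_deriv mul0r mul0r add0r => E.
apply: (mulfI n0); rewrite E mulrA mulrN divff// mulN1r -sumrN.
apply: eq_bigr => j _; rewrite /fps_deriv lift0 subSS /=.
by ring.
Qed.

Lemma PP_series_cvg n : cvg_in_prob rho (fun N l => PP_series l q n) (fps_exp L n).
Proof.
elim/ltn_ind: n => -[|n] IH.
  rewrite fps_exp0.
  by apply: eq_cvg_in_prob (cvg_in_prob_cst rhoP 1) => //; apply: nearW.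
rewrite fps_expS_rec.
apply: (@eq_cvg_in_prob _ _ rhoP (fun N l => - n.+1%:R^-1 * \sum_(j < n.+1)
    (\sum_(m < j.+1) 'C(j.+1, m)%:R * (q * (q / N%:R) ^+ (j - m)) * PP_moment 0 l m)
    * PP_series l q (n - j)%N)).
  near=> N => l ls; rewrite [RHS]PP_series_rec//.
  by near: N; exact: nbhs_infty_gt.
apply: (cvg_in_probM rhoP (cvg_in_prob_cst rhoP _)).
apply: (cvg_in_prob_sum rhoP) => j; apply: (cvg_in_probM rhoP); last by apply: IH; rewrite ltnS leq_subr.
(* The powers of 0 leave only [m = j], with binomial coefficient [j + 1]. *)
have -> : j.+1%:R * (q * m0 j) = \sum_(m < j.+1) 'C(j.+1, m)%:R * (q * 0 ^+ (j - m)) * m0 m.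
  rewrite big_ord_recr/= subnn expr0 mulr1 binSn mulrA big1 ?add0r//.
  by move=> m _; rewrite expr0n subn_eq0 leqNgt ltn_ord !mulr0 mul0r.
apply: (cvg_in_prob_sum rhoP) => m; apply: (cvg_in_probM rhoP); last exact: cvg0.
apply: (cvg_in_prob_deterministic rhoP) => //; apply: cvgMr; apply: cvgMr.
exact: cvg_invn_exp.
Unshelve. all: by end_near. Qed.

Lemma PP_moments_cvg : q != 0 ->
  moments_cvg_in_prob rho q (fun k => - q^-1 * fps_exp L k.+1).
Proof.
move=> q0 k; apply: (eq_cvg_in_prob rhoP _ (cvg_in_probM rhoP (cvg_in_prob_cst rhoP (- q^-1)) (PP_series_cvg k.+1))).
near=> N => l ls; rewrite PP_seriesS//; first by field.
by near: N; exact: nbhs_infty_gt.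
Unshelve. all: by end_near. Qed.

(** For [N > 0] the zeroth PP(0) moment of every signature is exactly 1. *)
Lemma moment0_limit : m0 0 = 1.
Proof.
apply/eqP; rewrite eq_sym -subr_eq0 -normr_le0; apply/ler_addgt0Pr => eps e0; rewrite add0r.
have h := cvg_in_prob_ex rhoP (cvg0 0) e0.
have [N [N0 [l ls]]] : exists N, (0 < N)%N /\ exists2 l : {ffun 'I_N -> int},
    is_signature l & `|PP_moment 0 l 0 - m0 0| <= eps.
  suff [N] : \forall N \near \oo, (0 < N)%N /\ exists2 l : {ffun 'I_N -> int},
    is_signature l & `|PP_moment 0 l 0 - m0 0| <= eps.
    by move=> _ /(_ N (leqnn N)); exists N.
  near=> N; split; first by near: N; exact: nbhs_infty_gt.
  by near: N.
rewrite PP_moment0// sumr_const card_ord mulVf//.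
by rewrite pnatr_eq0 -lt0n.
Unshelve. all: by end_near. Qed.

(* Squared deviations are summed so that a single event controls the first [n] moments. *)
Lemma good_signature mq n : moments_cvg_in_prob rho q mq ->
  exists N (l : {ffun 'I_N -> int}), [/\ (0 < N)%N, is_signature l &
    forall k, (k < n)%N -> `|PP_moment q l k - mq k| <= n.+1%:R^-1].
Proof.
move=> cvgq.
have sq k : cvg_in_prob rho (fun N l => (PP_moment q l k - mq k) * (PP_moment q l k - mq k)) 0.
  have d0 : cvg_in_prob rho (fun N l => PP_moment q l k - mq k) 0.
    by rewrite -(subrr (mq k)); apply: (cvg_in_probD rhoP); [exact: cvgq|exact: cvg_in_prob_cst].
  by rewrite -(mulr0 0); apply: (cvg_in_probM rhoP).
have := cvg_in_prob_sum rhoP (fun i : 'I_n => sq i); rewrite big1// => sumsq.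
have e0 : 0 < (n.+1%:R^-1 : R) ^+ 2 by rewrite exprn_gt0// invr_gt0 ltr0n.
have [N [N0 [l ls]]] : exists N, (0 < N)%N /\ exists2 l : {ffun 'I_N -> int},
    is_signature l & `|\sum_(k < n) (PP_moment q l k - mq k) * (PP_moment q l k - mq k) - 0| <= n.+1%:R^-1 ^+ 2.
  suff [N] : \forall N \near \oo, (0 < N)%N /\ exists2 l : {ffun 'I_N -> int},
    is_signature l & `|\sum_(k < n) (PP_moment q l k - mq k) * (PP_moment q l k - mq k) - 0| <= n.+1%:R^-1 ^+ 2.
    by move=> _ /(_ N (leqnn N)); exists N.
  near=> N; split; first by near: N; exact: nbhs_infty_gt.
  by near: N; exact: (cvg_in_prob_ex rhoP sumsq e0).
rewrite subr0 => hl; exists N, l; split => // k kn.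
rewrite -(@ler_pXn2r _ 2)// ?nnegrE ?invr_ge0//; apply: le_trans hl.
rewrite (bigD1 (Ordinal kn))//= -expr2 real_normK ?num_real// ger0_norm.
  by rewrite lerDl sumr_ge0// => i _; rewrite -expr2 sqr_ge0.
by rewrite addr_ge0 ?sqr_ge0// sumr_ge0// => i _; rewrite -expr2 sqr_ge0.
Unshelve. all: by end_near. Qed.

End LimitMoments.

(** * Monotone functions and quantile functions of atomic measures *)

Lemma nondecreasing_in_measurable (R : realType) (a b : R) (f : R -> R) :
  {in `]a, b[ &, {homo f : s t / s <= t}} -> measurable_fun `]a, b[ f.
Proof.
move=> ndf; apply: (measurability (@RGenCInfty.G R)) => //= [|_ [_] [r] -> <-].
  exact: RGenCInfty.measurableE.
apply: is_interval_measurable => s t/= [sD]; rewrite in_itv/= andbT => fs [tD _] u /andP[su ut].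
have uD : u \in `]a, b[ by move: sD tD; rewrite !in_itv/= => /andP[? ?] /andP[? ?]; apply/andP; split; lra.
by split => //; rewrite in_itv/= andbT (le_trans fs)// ndf.
Qed.

Section Quantile.
Variables (R : realType) (N : nat) (w x : 'I_N -> R).
Hypothesis w0 : forall i, 0 <= w i.
Hypothesis w1 : \sum_(i < N) w i = 1.
Hypothesis xmono : forall i j : 'I_N, (i <= j)%N -> x i <= x j.
Local Notation mu := (@lebesgue_measure R).

Definition partial_mass (n : nat) : R := \sum_(j < N | (j < n)%N) w j.
Local Notation S := partial_mass.

Lemma partial_mass0 : S 0 = 0.
Proof. by rewrite /S big_pred0. Qed.

Lemma partial_massT : S N = 1.
Proof. by rewrite -w1; apply: eq_bigl => i; rewrite ltn_ord. Qed.

Lemma partial_massS (i : 'I_N) : S i.+1 = S i + w i.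
Proof.
rewrite /S (bigD1 i)//= addrC; congr (_ + _); apply: eq_bigl => j.
by rewrite ltnS (ltn_neqAle j i) andbC.
Qed.

Lemma partial_mass_le m n : (m <= n)%N -> S m <= S n.
Proof.
move=> mn; rewrite /S big_mkcond [leRHS]big_mkcond; apply: ler_sum => i _.
case: ifPn => [im|_]; first by rewrite (leq_trans im mn).
by case: ifP.
Qed.

(** Half-open cells tile [[0, 1[] without overlap; an atom of weight 0 gets an empty cell. *)
Definition cell (i : 'I_N) : set R := `[S i, S i.+1[.

Lemma cell_ex t : 0 <= t < 1 -> exists i, cell i t.
Proof.
move=> /andP[t0 t1]; have Pn : exists n, t < S n by exists N; rewrite partial_massT.
case: (ex_minnP Pn) => -[|n]; first by rewrite partial_mass0 ltNge t0.
move=> tn nmin; have nN : (n < N)%N by apply: nmin; rewrite partial_massT.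
exists (Ordinal nN); rewrite /cell/= in_itv/= tn andbT leNgt; apply/negP => /nmin.
by rewrite ltnn.
Qed.

Lemma cell_le i j s t : cell i s -> cell j t -> s <= t -> (i <= j)%N.
Proof.
rewrite /cell/= !in_itv/= => /andP[si _] /andP[_ tj] st.
rewrite leqNgt; apply/negP => /partial_mass_le ji; lra.
Qed.

Lemma cell_sum (y : 'I_N -> R) i t : cell i t -> \sum_j y j * \1_(cell j) t = y i.
Proof.
move=> it; rewrite (bigD1 i)//= indicE mem_set// mulr1 big1 ?addr0// => j ji.
rewrite indicE memNset ?mulr0// => jt; move/eqP: ji; apply; apply/val_inj/eqP.
by rewrite eqn_leq (cell_le jt it)// (cell_le it jt).
Qed.

(** Writing the step function as a combination of indicators makes its powers integrable term by
    term. *)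
Definition quantile (t : R) : R := \sum_i x i * \1_(cell i) t.

Lemma quantile_le s t : 0 <= s -> s <= t -> t < 1 -> quantile s <= quantile t.
Proof.
move=> s0 st t1.
have [|i si] := @cell_ex s; first by apply/andP; split => //; lra.
have [|j tj] := @cell_ex t; first by apply/andP; split => //; lra.
by rewrite /quantile (cell_sum x si) (cell_sum x tj) xmono// (cell_le si tj).
Qed.

Lemma measurable_cell i : measurable (cell i).
Proof. exact: measurable_itv. Qed.

Lemma mu_cell i : mu (cell i `&` `[0, 1[) = (w i)%:E.
Proof.
rewrite setIidl; last first.
  move=> t; rewrite /cell/= !in_itv/= => /andP[it ti]; apply/andP; split.
    by apply: le_trans it; rewrite -partial_mass0 partial_mass_le.
  by apply: lt_le_trans ti _; rewrite -partial_massT partial_mass_le.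
rewrite lebesgue_measure_itv/= lte_fin partial_massS ltrDl.
rewrite -EFinD addrAC subrr add0r; case: ifPn => //; rewrite -leNgt => wi.
by congr (_%:E); apply/le_anti; rewrite wi w0.
Qed.

Lemma measurable_quantile : measurable_fun `]0 : R, 1 : R[ quantile.
Proof.
apply: nondecreasing_in_measurable => s t; rewrite !in_itv/= => /andP[s0 s1] /andP[t0 t1] st.
by apply: quantile_le => //; exact: ltW.
Qed.

Lemma integral_quantileX k :
  (\int[mu]_(t in `]0%R, 1%R[) (quantile t ^+ k)%:E = (\sum_i w i * x i ^+ k)%:E)%E.
Proof.
(* Adding the null point 0 gives [[0, 1[], which the cells cover exactly. *)
rewrite -(@integral_itv_bndoo _ _ _ _ true true); last first.
  by apply/measurable_EFinP; apply: measurable_funX; exact: measurable_quantile.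
transitivity (\int[mu]_(t in `[0%R, 1%R[) (\sum_i (x i ^+ k)%:E * (\1_(cell i) t)%:E))%E.
  apply: eq_integral => t; rewrite inE/= in_itv/= => /cell_ex[i it].
  rewrite /quantile (cell_sum x it) -(cell_sum (fun i => x i ^+ k) it) -sumEFin.
  by apply: eq_bigr => j _; rewrite EFinM.
have ii (i : 'I_N) : mu.-integrable `[0, 1[ (fun t => (\1_(cell i) t)%:E).
  apply: (@integrableS _ _ _ mu setT) => //; exact: integrable_indic_itv.
rewrite integral_sum//; last by move=> i; exact: integrableZl.
rewrite -sumEFin; apply: eq_bigr => i _; rewrite integralZl// integral_indic//.
  by rewrite [X in (_ * X)%E]mu_cell -EFinM mulrC.
exact: measurable_cell.
Qed.

End Quantile.

(** * Pointwise bounds on a monotone function from its even moments *)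

Section TailBound.
Variables (R : realType) (Q : R -> R) (M : R) (k : nat).
Local Notation mu := (@lebesgue_measure R).
Hypothesis Qmono : {in `]0, 1[ &, {homo Q : s t / s <= t}}.
Hypothesis QM : (\int[mu]_(t in `]0%R, 1%R[) (Q t ^+ (k.*2))%:E = M%:E)%E.

Lemma measurable_QX j : measurable_fun `]0 : R, 1 : R[ (fun t => (Q t ^+ j)%:E).
Proof.
by apply/measurable_EFinP; apply: measurable_funX; exact: nondecreasing_in_measurable.
Qed.

Lemma even_exp_ge0 (y : R) : 0 <= y ^+ k.*2.
Proof. by rewrite exprn_even_ge0// odd_double. Qed.

Lemma tail_subinterval (a b c : R) : 0 <= a -> a <= b -> b <= 1 ->
  (forall t, a < t < b -> c <= Q t ^+ k.*2) -> c * (b - a) <= M.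
Proof.
move=> a0 ab b1 h; rewrite -lee_fin -QM.
have sub : `]a, b[ `<=` `]0, 1[.
  by move=> t /=; rewrite !in_itv/= => /andP[? ?]; apply/andP; split; lra.
apply: (@le_trans _ _ (\int[mu]_(t in `]a, b[) (Q t ^+ (k.*2))%:E)%E); last first.
  apply: ge0_subset_integral => //; first exact: measurable_QX.
  by move=> t _; rewrite lee_fin even_exp_ge0.
have [c0|c0] := leP 0 c; last first.
  apply: (@le_trans _ _ 0%E); first by rewrite lee_fin mulr_le0_ge0// ?subr_ge0// ltW.
  by apply: integral_ge0 => t _; rewrite lee_fin even_exp_ge0.
apply: (@le_trans _ _ (\int[mu]_(t in `]a, b[) c%:E)%E).
  rewrite integral_cst// [X in (_ * X)%E]lebesgue_measure_itv/= lte_fin.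
  case: ltP => [_|ba]; first by rewrite EFinM EFinB.
  have -> : b - a = 0 by lra.
  by rewrite mulr0 mule0.
apply: ge0_le_integral => //.
by apply: measurable_funS (measurable_QX _) => //.
Qed.

(** A Chebyshev argument: by monotonicity [|Q|] is at least [|Q t|] on all of []t, 1[] if
    [Q t >= 0], and on all of []0, t[] otherwise. *)
Lemma tail_bound t : 0 < t < 1 -> Q t ^+ k.*2 * Num.min t (1 - t) <= M.
Proof.
move=> /andP[t0 t1]; have tin : t \in `]0, 1[ by rewrite in_itv/= t0 t1.
have [Q0|Q0] := leP 0 (Q t).
  apply: (@le_trans _ _ (Q t ^+ k.*2 * (1 - t))).
    by rewrite ler_wpM2l ?even_exp_ge0// ge_min lexx orbT.
  apply: tail_subinterval; try lra.
  move=> s /andP[ts s1]; apply: lerXn2r; rewrite ?nnegrE//.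
    by rewrite (le_trans Q0)// Qmono ?in_itv/= ?ltW//; apply/andP; split; lra.
  by rewrite Qmono ?in_itv/= ?ltW//; apply/andP; split; lra.
apply: (@le_trans _ _ (Q t ^+ k.*2 * (t - 0))).
  by rewrite ler_wpM2l ?even_exp_ge0// subr0 ge_min lexx.
apply: tail_subinterval; try lra.
move=> s /andP[s0 st].
have Qst : Q s <= Q t by rewrite Qmono ?in_itv/= ?ltW//; apply/andP; split; lra.
rewrite -[Q t ^+ _]ger0_norm ?even_exp_ge0// -[Q s ^+ _]ger0_norm ?even_exp_ge0// !normrX.
by apply: lerXn2r; rewrite ?nnegrE// !ltr0_norm// ?lerN2//; exact: le_lt_trans Q0.
Qed.

End TailBound.

(** * An integrable dominating function on the unit interval *)

Section Dominating.
Variable R : realType.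
Local Notation mu := (@lebesgue_measure R).

(** The derivative of [sqrt t - sqrt (1 - t)]; this normalisation makes its integral explicit. *)
Definition edge_bound (t : R) : R := (2 * Num.sqrt t)^-1 + (2 * Num.sqrt (1 - t))^-1.

Lemma edge_bound_ge0 t : 0 <= edge_bound t.
Proof. by rewrite addr_ge0// invr_ge0 mulr_ge0// sqrtr_ge0. Qed.

(** Multiplied into [tail_bound], this replaces the factor [min t (1 - t)] by a bound on [Q t ^+ k]
    through [edge_bound t]. *)
Lemma edge_bound_min (t : R) : 0 < t < 1 -> 1 <= 4 * edge_bound t ^+ 2 * Num.min t (1 - t).
Proof.
move=> /andP[t0 t1].
have key (u v : R) : 0 < u -> 0 <= v -> 1 <= 4 * ((2 * Num.sqrt u)^-1 + v) ^+ 2 * u.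
  move=> u0 v0; have su : 0 < Num.sqrt u by rewrite sqrtr_gt0.
  have {2}-> : u = Num.sqrt u ^+ 2 by rewrite sqr_sqrtr// ltW.
  have -> : 4 * ((2 * Num.sqrt u)^-1 + v) ^+ 2 * Num.sqrt u ^+ 2 = (1 + 2 * v * Num.sqrt u) ^+ 2.
    by field; rewrite gt_eqF.
  by rewrite -[leLHS](expr1n _ 2) ler_sqr ?nnegrE// ?addr_ge0// ?lerDl !mulr_ge0// ltW.
have [h|h] := leP t (1 - t).
  by rewrite /edge_bound; apply: key => //; rewrite invr_ge0 mulr_ge0// sqrtr_ge0.
rewrite /edge_bound addrC; apply: key; first by rewrite subr_gt0.
by rewrite invr_ge0 mulr_ge0// sqrtr_ge0.
Qed.

Let F (t : R) : R := Num.sqrt t - Num.sqrt (1 - t).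

Lemma is_derive_edge (t : R) : 0 < t < 1 -> is_derive t 1 F (edge_bound t).
Proof.
move=> /andP[t0 t1].
have d1 : is_derive t 1 Num.sqrt (2 * Num.sqrt t)^-1 by exact: is_derive1_sqrt.
have d2 : is_derive t 1 (fun s : R => Num.sqrt (1 - s)) (- (2 * Num.sqrt (1 - t))^-1).
  have t1' : 0 < 1 - t by rewrite subr_gt0.
  have d3 : is_derive (1 - t) 1 Num.sqrt (2 * Num.sqrt (1 - t))^-1 by exact: is_derive1_sqrt.
  have d4 : is_derive t 1 (fun s : R => 1 - s) (-1).
    by rewrite -[-1]sub0r; apply: is_deriveB.
  have := @is_derive1_comp _ Num.sqrt (fun s : R => 1 - s) t _ _ d3 d4.
  by rewrite mulrN1.
rewrite /edge_bound -[(2 * Num.sqrt (1 - t))^-1]opprK.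
exact: is_deriveB.
Qed.

Lemma continuous_edge_bound (t : R) : 0 < t < 1 -> {for t, continuous edge_bound}.
Proof.
move=> /andP[t0 t1]; apply: cvgD; apply: cvgV.
- by rewrite mulf_neq0// gt_eqF// sqrtr_gt0.
- by apply: cvgMr; exact: sqrt_continuous.
- by rewrite mulf_neq0// gt_eqF// sqrtr_gt0 subr_gt0.
- apply: cvgMr; apply: (@cvg_comp _ _ _ (fun s : R => 1 - s) Num.sqrt); last exact: sqrt_continuous.
  by apply: cvgB; [exact: cvg_cst|exact: cvg_id].
Qed.

(** The antiderivative [F] takes values in [[-1, 1]], so the bound is uniform in [a] and [b]. *)
Lemma integral_edge_bound_le (a b : R) : 0 < a -> a < b -> b < 1 ->
  (\int[mu]_(t in `[a, b]) (edge_bound t)%:E <= 2%:E)%E.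
Proof.
move=> a0 ab b1.
have inab t : t \in `[a, b] -> 0 < t < 1 by rewrite in_itv/= => /andP[? ?]; apply/andP; split; lra.
rewrite (@continuous_FTC2 _ _ F)//.
- rewrite -EFinB lee_fin /F.
  have s1 t : 0 <= t <= 1 -> 0 <= Num.sqrt t <= 1.
    move=> /andP[? t1]; rewrite sqrtr_ge0/= -(ler_sqr) ?nnegrE ?sqrtr_ge0//.
    by rewrite sqr_sqrtr// expr1n.
  have /s1 : 0 <= b <= 1 by apply/andP; split; lra.
  have /s1 : 0 <= 1 - b <= 1 by apply/andP; split; lra.
  have /s1 : 0 <= a <= 1 by apply/andP; split; lra.
  have /s1 : 0 <= 1 - a <= 1 by apply/andP; split; lra.
  lra.
- apply: continuous_in_subspaceT => t; rewrite inE/= => /inab.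
  exact: continuous_edge_bound.
- have cF t : F @ t --> F t.
    apply: cvgB; first exact: sqrt_continuous.
    apply: (@cvg_comp _ _ _ (fun s : R => 1 - s) Num.sqrt); last exact: sqrt_continuous.
    by apply: cvgB; [exact: cvg_cst|exact: cvg_id].
  split.
  + move=> t /subset_itv_oo_cc/inab/is_derive_edge h; exact: ex_derive.
  + exact/cvg_at_right_filter/cF.
  + exact/cvg_at_left_filter/cF.
- move=> t /subset_itv_oo_cc/inab/is_derive_edge h; rewrite derive1E; exact: derive_val.
Qed.

Lemma integrable_edge_bound : mu.-integrable `]0, 1[ (fun t => (edge_bound t)%:E).
Proof.
(* Exhaustion of []0, 1[] by compact intervals; [n + 3] keeps [c n] below 1/2, and the existential
   keeps [c] opaque. *)
have [c cE] : exists c : nat -> R, forall n, c n = n.+3%:R^-1 by eexists.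
have c0 n : 0 < c n by rewrite cE invr_gt0.
pose J n : set R := `[c n, 1 - c n]%classic.
have JU : \bigcup_n J n = `]0, 1[%classic.
  apply/seteqP; split => [t [n _]|t]; rewrite /J/= !in_itv/=.
    by have h := c0 n; move=> /andP[? ?]; apply/andP; split; lra.
  move=> /andP[t0 t1]; have m0 : 0 < Num.min t (1 - t) by rewrite lt_min t0 subr_gt0.
  exists (Num.bound (Num.min t (1 - t))^-1) => //=; rewrite in_itv/=.
  set n := Num.bound _.
  have hn : c n <= Num.min t (1 - t).
    rewrite cE invf_ple ?posrE//; apply: ltW.
    apply: lt_le_trans (archi_boundP _) _; first by rewrite invr_ge0 ltW.
    by rewrite ler_nat -/n; lia.
  move: hn; rewrite le_min => /andP[h1 h2]; apply/andP; split; lra.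
have inJ n t : J n t -> 0 < t < 1.
  move=> Jt; have : (\bigcup_n J n) t by exists n.
  by rewrite JU /= in_itv.
have Jmeas n : measurable_fun (J n) (fun t => (edge_bound t)%:E).
  apply/measurable_EFinP; apply: (@measurable_funS _ _ _ _ `]0 : R, 1 : R[) => //.
    by move=> t /inJ; rewrite /= in_itv.
  apply: open_continuous_measurable_fun => // t; rewrite inE/= in_itv/=.
  exact: continuous_edge_bound.
have Dmeas : measurable_fun `]0 : R, 1 : R[ (fun t => (edge_bound t)%:E).
  apply/measurable_EFinP; apply: open_continuous_measurable_fun => // t; rewrite inE/= in_itv/=.
  exact: continuous_edge_bound.
apply/integrableP; split => //.
under eq_integral do rewrite gee0_abs ?lee_fin ?edge_bound_ge0//.
apply: (@le_lt_trans _ _ 2%:E); last exact: ltry.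
rewrite -JU.
have cv : (\int[mu]_(x in J i) (edge_bound x)%:E)%E @[i --> \oo] -->
    (\int[mu]_(x in \bigcup_i J i) (edge_bound x)%:E)%E.
  apply: ge0_nondecreasing_set_cvg_integral => //.
  - apply/nondecreasing_seqP => n; apply/subsetPset => t; rewrite /J/= !in_itv/=.
    have : c n.+1 <= c n by rewrite !cE lef_pV2 ?posrE// ler_nat.
    by move=> h /andP[? ?]; apply/andP; split; lra.
  - by move=> n; exact: measurable_itv.
  - by move=> n t _; rewrite lee_fin edge_bound_ge0.
rewrite -(cvg_lim _ cv)//; apply: lime_le.
  by apply/cvg_ex; eexists; exact: cv.
apply: nearW => n; rewrite /J; apply: integral_edge_bound_le.
- exact: c0.
- have : c n <= 3^-1 by rewrite cE lef_pV2 ?posrE// ler_nat.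
  by have := c0 n; lra.
- by rewrite ltrBlDr ltrDl c0.
Qed.

End Dominating.

(** * Helly selection for monotone functions *)

Section Helly.
Variables (R : realType) (Q : nat -> R -> R) (b : R -> R).
Hypothesis Qmono : forall n, {in `]0, 1[ &, {homo Q n : s t / s <= t}}.
Hypothesis Qb : forall n t, 0 < t < 1 -> `|Q n t| <= b t.
Local Notation mu := (@lebesgue_measure R).

(** A product of segments is compact, so the sequence has a cluster point [f] for pointwise
    convergence. A neighbourhood in the product constrains finitely many coordinates, hence the
    finite list [s]. *)
Lemma pointwise_cluster : exists f : R -> R, forall (s : seq R) (eps : R) n0, 0 < eps ->
  exists2 n, (n0 <= n)%N & forall t, t \in s -> 0 < t < 1 -> `|f t - Q n t| < eps.
Proof.
(* Extension by 0 outside []0, 1[] places every coordinate in a segment. *)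
pose Q' n t := if 0 < t < 1 then Q n t else 0.
pose b' t := if 0 < t < 1 then b t else 0.
have Q'b n t : `[- b' t, b' t]%classic (Q' n t).
  rewrite /= in_itv/= -ler_norml /Q' /b'; case: ifP => [/Qb//|_]; rewrite ?normr0//.
have := @tychonoff R (fun _ => R) (fun t => `[- b' t, b' t]%classic) (fun t => @segment_compact R _ _).
have FF : ProperFilter (Q' @ \oo) by exact: fmap_proper_filter.
move=> /(_ _ FF)[|f [_ clf]].
  by exists 0%N => // n _ t; exact: Q'b.
exists f => s eps n0 e0.
have nb : nbhs f [set g : {ptws R -> R} | forall t, t \in s -> `|f t - g t| < eps].
  elim: s => [|t s IH]; first by apply: filterS filterT => g _ t.
  have nt : nbhs f [set g : {ptws R -> R} | `|f t - g t| < eps].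
    have nt : nbhs (f t) [set y : R | `|f t - y| < eps] by exists eps.
    exact: (@proj_continuous R (fun _ => R) t f _ nt).
  apply: filterS (filterI nt IH) => g [h1 h2] u; rewrite inE => /predU1P[->//|us].
  exact: h2.
have tail : (Q' @ \oo) [set g | exists2 n, (n0 <= n)%N & g = Q' n].
  by exists n0 => // n /= n0n; exists n.
have [g [[n n0n ->] h]] := clf _ _ tail nb.
exists n => // t ts t01; move: (h t ts); by rewrite /Q' t01.
Qed.

Lemma helly_selection : exists (f : R -> R) (phi : nat -> nat),
  [/\ {in `]0, 1[ &, {homo f : s t / s <= t}}, (forall n, (n <= phi n)%N) &
      {ae mu, forall t, `]0, 1[%classic t -> Q (phi n) t @[n --> \oo] --> f t}].
Proof.
have [f fP] := pointwise_cluster.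
have fmono : {in `]0, 1[ &, {homo f : s t / s <= t}}.
  move=> s t s01 t01 st; apply/ler_addgt0Pr => eps e0.
  have e2 : 0 < eps / 2 by rewrite divr_gt0.
  have [n _ h] := fP [:: s; t] (eps / 2) 0%N e2.
  have hs : `|f s - Q n s| < eps / 2 by apply: h; rewrite ?inE ?eqxx// -in_itv.
  have ht : `|f t - Q n t| < eps / 2 by apply: h; rewrite ?inE ?eqxx ?orbT// -in_itv.
  have := Qmono n s01 t01 st.
  move: hs ht; rewrite !ltr_norml => /andP[? ?] /andP[? ?]; lra.
(* An enumeration of the rationals; naturals that code no rational are sent to 0. *)
pose r (j : nat) : R := ratr (odflt 0 (unpickle j)).
(* The index [phi n] approximates [f] to within [1/(n+1)] at the first [n] rationals; [n <= phi n]
   is enough to go to infinity. *)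
have /choice[phi phiP] n : exists m, (n <= m)%N /\
    forall j, (j < n)%N -> 0 < r j < 1 -> `|f (r j) - Q m (r j)| < n.+1%:R^-1.
  have [|m nm h] := fP [seq r j | j <- iota 0 n] n.+1%:R^-1 n; first by rewrite invr_gt0.
  by exists m; split => // j jn; apply: h; apply: map_f; rewrite mem_iota.
have ratcvg (x : rat) : 0 < (ratr x : R) < 1 -> Q (phi n) (ratr x) @[n --> \oo] --> f (ratr x).
  move=> x01; apply/cvgrPdist_lt => eps e0.
  have rx : ratr x = r (pickle x) by rewrite /r pickleK.
  near=> n; rewrite rx.
  apply: (@lt_trans _ _ n.+1%:R^-1); last by near: n; exact: near_infty_natSinv_lt (PosNum e0).
  apply: (phiP n).2; last by rewrite -rx.
  by near: n; exact: nbhs_infty_gt.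
exists f, phi; split => //; first by move=> n; have [] := phiP n.
have [c cE] : exists c : nat -> R, forall n, c n = n.+3%:R^-1 by eexists.
(* The exceptional set is the countable set of jumps of [f], collected over intervals whose closures
   lie in []0, 1[]. *)
pose B n := [set x | x \in (`]c n, 1 - c n[) /\ discontinuity f x].
have c0 n : 0 < c n by rewrite cE invr_gt0.
have fmonoc n : {in `[c n, 1 - c n] &, nondecreasing_fun f}.
  have := c0 n; move=> c0' s t; rewrite !in_itv/= => /andP[? ?] /andP[? ?].
  by apply: fmono; rewrite in_itv/=; apply/andP; split; lra.
have cB : countable (\bigcup_n B n).
  by apply: bigcup_countable => // n _; exact: discontinuity_countable.
exists (\bigcup_n B n); split.
- by apply: countable_measurable => // t; exact: measurable_set1.
- exact: countable_lebesgue_measure0.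
move=> t /= /not_implyP[t01 nocv]; apply: contrapT => nB; apply: nocv.
have [t0 t1] : 0 < t /\ t < 1 by move: t01; rewrite /= in_itv/= => /andP.
have [n tn] : exists n, t \in `]c n, 1 - c n[.
  have m0 : 0 < Num.min t (1 - t) by rewrite lt_min t0 subr_gt0.
  have [n _ hn] := @near_infty_natSinv_lt R (PosNum m0).
  have {}hn : c n < Num.min t (1 - t) by rewrite cE; apply: (hn n.+2) => /=; lia.
  exists n; move: hn; rewrite lt_min in_itv/= => /andP[h1 h2].
  by apply/andP; split; lra.
have cvl : cvg (f x @[x --> t^'-]).
  apply: nondecreasing_at_left_is_cvgr; near=> s.
    have s0 : 0 < s by near: s; exact: nbhs_left_gt.
    move=> x y; rewrite !in_itv/= => /andP[? ?] /andP[? ?].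
    by apply: fmono; rewrite in_itv/=; apply/andP; split; lra.
  have s0 : 0 < s by near: s; exact: nbhs_left_gt.
  exists (f t) => _ [y /= + <-]; rewrite in_itv/= => /andP[? yt].
  by apply: fmono (ltW yt); rewrite in_itv/=; apply/andP; split; lra.
have cvr : cvg (f x @[x --> t^'+]).
  apply: nondecreasing_at_right_is_cvgr; near=> s.
    have s0 : s < 1 by near: s; exact: nbhs_right_lt.
    move=> x y; rewrite !in_itv/= => /andP[? ?] /andP[? ?].
    by apply: fmono; rewrite in_itv/=; apply/andP; split; lra.
  have s0 : s < 1 by near: s; exact: nbhs_right_lt.
  exists (f t) => _ [y /= + <-]; rewrite in_itv/= => /andP[ty ?].
  by apply: fmono (ltW ty); rewrite in_itv/=; apply/andP; split; lra.
(* Outside the exceptional set there is no jump at [t], so the one-sided limits agree. *)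
have limE : lim (f x @[x --> t^'-]) = lim (f x @[x --> t^'+]).
  by apply/eqP/negPn/negP => h; apply: nB; exists n.
apply/cvgrPdist_le => eps e0; have e4 : 0 < eps / 4 by rewrite divr_gt0.
(* Rationals [a < t < d] are chosen with [f a] and [f d] within [eps/4] of the common limit.
   Monotonicity traps [f t] between [f a] and [f d], and [Q (phi m) t] between values within [eps/4]
   of these. *)
have [a [a0 at_ fa]] : exists x : rat, [/\ 0 < (ratr x : R), ratr x < t &
    `|lim (f x @[x --> t^'-]) - f (ratr x)| < eps / 4].
  have /cvgrPdist_lt/(_ _ e4) h := cvl.
  have [y [yt y0 hy]] : exists y, [/\ y < t, 0 < y & forall z, y < z < t ->
      `|lim (f x @[x --> t^'-]) - f z| < eps / 4].
    have [d /= d0 hd] := h; exists (Num.max (t - d) (t / 2)).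
    split; first by rewrite gt_max; apply/andP; split; lra.
      by rewrite lt_max; apply/orP; right; lra.
    move=> z /andP[]; rewrite gt_max => /andP[z1 z2] zt; apply: hd => //=.
    by rewrite ger0_norm; lra.
  have [x] := rat_in_itvoo yt; rewrite in_itv/= => /andP[yx xt].
  by exists x; split => //; [lra|rewrite hy// yx xt].
have [d [d1 td fd]] : exists x : rat, [/\ (ratr x : R) < 1, t < ratr x &
    `|lim (f x @[x --> t^'+]) - f (ratr x)| < eps / 4].
  have /cvgrPdist_lt/(_ _ e4) h := cvr.
  have [y [yt y0 hy]] : exists y, [/\ t < y, y < 1 & forall z, t < z < y ->
      `|lim (f x @[x --> t^'+]) - f z| < eps / 4].
    have [d /= d0 hd] := h; exists (Num.min (t + d) ((t + 1) / 2)).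
    split; first by rewrite lt_min; apply/andP; split; lra.
      by rewrite gt_min; apply/orP; right; lra.
    move=> z /andP[zt]; rewrite lt_min => /andP[z1 z2]; apply: hd => //=.
    by rewrite distrC ger0_norm; lra.
  have [x] := rat_in_itvoo yt; rewrite in_itv/= => /andP[yx xt].
  by exists x; split => //; [lra|rewrite hy// yx xt].
have a01 : 0 < (ratr a : R) < 1 by apply/andP; split; lra.
have d01 : 0 < (ratr d : R) < 1 by apply/andP; split; lra.
have /cvgrPdist_lt/(_ _ e4) ca := ratcvg _ a01.
have /cvgrPdist_lt/(_ _ e4) cd := ratcvg _ d01.
apply: filterS2 ca cd => m ha hd.
have tin : t \in `]0, 1[ by rewrite in_itv/= t0 t1.
have ain : (ratr a : R) \in `]0, 1[ by rewrite in_itv.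
have din : (ratr d : R) \in `]0, 1[ by rewrite in_itv.
have := Qmono (phi m) ain tin (ltW at_); have := Qmono (phi m) tin din (ltW td).
have := fmono _ _ ain tin (ltW at_); have := fmono _ _ tin din (ltW td).
move: ha hd fa fd; rewrite limE !ltr_norml ler_norml.
move=> /andP[? ?] /andP[? ?] /andP[? ?] /andP[? ?] *; apply/andP; split; lra.
Unshelve. all: by end_near. Qed.

End Helly.

(** * Passage to the limit: from quantile functions to a law *)

Lemma integral_uniform01 (R : realType) (h : R -> \bar R) : measurable_fun setT h ->
  (@lebesgue_measure R).-integrable `]0, 1[ h ->
  (uniform_prob (@ltr01 R)).-integrable setT h /\
  (\int[uniform_prob (@ltr01 R)]_x h x = \int[@lebesgue_measure R]_(x in `]0%R, 1%R[) h x)%E.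
Proof.
move=> mh ih.
have pos (g : R -> \bar R) : measurable_fun setT g -> (forall x, 0 <= g x)%E ->
  (\int[uniform_prob (@ltr01 R)]_x g x = \int[@lebesgue_measure R]_(x in `]0%R, 1%R[) g x)%E.
  move=> mg g0; rewrite integral_uniform// subr0 invr1 mul1e integral_itv_bndoo//.
  exact: measurable_funTS.
split.
  apply/integrableP; split => //; rewrite pos//; last exact: measurableT_comp.
  by case/integrableP: ih.
rewrite integralE [RHS]integralE; congr (_ - _)%E; apply: pos => //.
  exact: measurable_funepos.
exact: measurable_funeneg.
Qed.

Lemma pushforward_moments (R : realType) (f : R -> R) (m : nat -> R) :
  measurable_fun `]0 : R, 1 : R[ f ->
  (forall k, (@lebesgue_measure R).-integrable `]0, 1[ (fun t => (f t ^+ k)%:E)) ->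
  (forall k, \int[@lebesgue_measure R]_(t in `]0%R, 1%R[) (f t ^+ k)%:E = (m k)%:E)%E ->
  exists P : probability R R,
    (forall k, P.-integrable [set: R] (fun x => (x ^+ k)%:E)) /\
    (forall k, (\int[P]_x (x ^+ k)%:E)%E = (m k)%:E).
Proof.
(* As [f] is controlled only on []0, 1[], it is extended by 0 to a random variable on the line; its
   law under the uniform probability is the witness. *)
move=> mf intf fm; pose g := f \_ (`]0, 1[%classic : set R).
have mg : measurable_fun [set: measurableTypeR R] (g : measurableTypeR R -> R).
  exact/(measurable_restrictT f).
pose X : {RV (uniform_prob (@ltr01 R)) >-> R} :=
  HB.pack g (isMeasurableFun.Build _ _ _ _ _ mg).
have gf k : {in `]0, 1[%classic, (fun t => (f t ^+ k)%:E) =1 (fun t => (g t ^+ k)%:E)}.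
  by move=> t t01; rewrite /g patchE t01.
have mXk k : measurable_fun [set: R] (fun x : R => (x ^+ k)%:E).
  by apply/measurable_EFinP; apply: measurable_funX.
have mgk k : measurable_fun [set: R] (fun t => (g t ^+ k)%:E).
  by apply/measurable_EFinP; apply: measurable_funX.
have H k : (uniform_prob (@ltr01 R)).-integrable setT (fun t => (g t ^+ k)%:E) /\
  (\int[uniform_prob (@ltr01 R)]_x (g x ^+ k)%:E = (m k)%:E)%E.
  have [|h1 h2] := integral_uniform01 (mgk k).
    by apply: eq_integrable (intf k) => //; exact: gf.
  by split => //; rewrite h2 -fm; apply: eq_integral => t /gf ->.
exists (distribution (uniform_prob (@ltr01 R)) X); split => k.
  by apply: integrable_pushforward => //; exact: (H k).1.
rewrite integral_distribution//; first exact: (H k).2.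
exact: (H k).1.
Qed.

(** Second moments provide the pointwise bound for Helly selection, and moments of order [2k]
    dominate the [k]-th powers. *)
Lemma limit_of_monotone_moments (R : realType) (m : nat -> R)
    (Q : nat -> R -> R) (M : nat -> nat -> R) :
  (forall n, {in `]0, 1[ &, {homo Q n : s t / s <= t}}) ->
  (forall n k, \int[@lebesgue_measure R]_(t in `]0%R, 1%R[) (Q n t ^+ k)%:E = (M n k)%:E)%E ->
  (forall n k, (k < n)%N -> `|M n k - m k| <= n.+1%:R^-1) ->
  exists P : probability R R,
    (forall k, P.-integrable [set: R] (fun x => (x ^+ k)%:E)) /\
    (forall k, (\int[P]_x (x ^+ k)%:E)%E = (m k)%:E).
Proof.
move=> Qmono QM Mm; set mu := @lebesgue_measure R.
have MB n k : (k < n)%N -> M n k <= m k + 1.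
  move=> /Mm; rewrite ler_norml => /andP[_ h].
  have : (n.+1%:R^-1 : R) <= 1 by rewrite invf_le1// ler1n.
  by move: (n.+1%:R^-1 : R) h => c; lra.
have tail n k t : (k.*2 < n)%N -> 0 < t < 1 ->
    Q n t ^+ k.*2 * Num.min t (1 - t) <= m k.*2 + 1.
  by move=> kn t01; apply: le_trans (MB _ _ kn); exact: (tail_bound (Qmono n) (QM n k.*2) t01).
have minp (t : R) : 0 < t < 1 -> 0 < Num.min t (1 - t).
  by move=> /andP[t0 t1]; rewrite lt_min t0 subr_gt0.
(* From [|y| <= y^2 + 1] and the tail bound for second moments. The shift [n + 3] below ensures that
   the moment of order 2 is controlled. *)
pose b (t : R) := (m 2 + 1) / Num.min t (1 - t) + 1.
have Qb n t : 0 < t < 1 -> `|Q (n + 3)%N t| <= b t.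
  move=> t01; have := @tail (n + 3)%N 1%N t; rewrite addn3 => /(_ isT t01).
  rewrite -ler_pdivlMr ?minp// -[1.*2]/2%N => h; rewrite /b.
  apply: (@le_trans _ _ (Q n.+3 t ^+ 2 + 1)); last by rewrite lerD2r.
  rewrite -[Q n.+3 t ^+ 2]real_normK ?num_real//.
  by have := sqr_ge0 (`|Q n.+3 t| - 1); have := normr_ge0 (Q n.+3 t); rewrite !expr2; nra.
have [f [phi [fmono phi_ge phicvg]]] :=
  @helly_selection R (fun n => Q (n + 3)%N) b (fun n => Qmono (n + 3)%N) Qb.
have mf : measurable_fun `]0 : R, 1 : R[ f by exact: nondecreasing_in_measurable.
have key k : mu.-integrable `]0, 1[ (fun t => (f t ^+ k)%:E) /\
    (\int[mu]_(t in `]0%R, 1%R[) (f t ^+ k)%:E = (m k)%:E)%E.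
  (* Starting at [n + 2k] makes the moment of order [2k] controlled along the whole sequence. *)
  pose psi n := (phi (n + k.*2) + 3)%N.
  have psi_ge n : (n + k.*2 < psi n)%N by have := phi_ge (n + k.*2)%N; rewrite /psi; lia.
  pose C := m k.*2 + 1.
  have dom n t : `]0, 1[%classic t -> (`|(Q (psi n) t ^+ k)%:E| <= (2 * (C + 1) * edge_bound t)%:E)%E.
    rewrite /= in_itv/= => t01.
    have h := @tail (psi n) k t (leq_ltn_trans (leq_addl _ _) (psi_ge n)) t01.
    have e1 := edge_bound_min t01; have e0 := edge_bound_ge0 t.
    have q0 := even_exp_ge0 k (Q (psi n) t).
    have C0 : 0 <= C by apply: le_trans h; rewrite mulr_ge0// ltW// minp.
    have C1 : 0 <= C + 1 by exact: addr_ge0 C0 ler01.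
    (* The bound is checked after squaring; [C <= (C + 1)^2] allows the constant [2 (C + 1)] in
       place of [2 sqrt C]. *)
    rewrite lee_fin -(@ler_pXn2r _ 2)// ?nnegrE ?mulr_ge0//.
    rewrite real_normK ?num_real// -exprM muln2.
    apply: (@le_trans _ _ (4 * edge_bound t ^+ 2 * C)).
      apply: (@le_trans _ _ (Q (psi n) t ^+ k.*2 * (4 * edge_bound t ^+ 2 * Num.min t (1 - t)))).
        by rewrite -[leLHS]mulr1 ler_wpM2l.
      rewrite mulrCA; apply: ler_wpM2l => //.
      by rewrite mulr_ge0// exprn_ge0.
    have -> : (2 * (C + 1) * edge_bound t) ^+ 2 = 4 * edge_bound t ^+ 2 * (C + 1) ^+ 2 by ring.
    apply: ler_wpM2l; first by rewrite mulr_ge0// exprn_ge0.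
    by rewrite expr2; nra.
  have mQ n : measurable_fun `]0 : R, 1 : R[ (fun t => (Q (psi n) t ^+ k)%:E).
    by apply: measurable_QX; exact: Qmono.
  have mfk : measurable_fun `]0 : R, 1 : R[ (fun t => (f t ^+ k)%:E).
    by apply/measurable_EFinP; apply: measurable_funX.
  have cvk : {ae mu, forall t, `]0, 1[%classic t ->
      (Q (psi n) t ^+ k)%:E @[n --> \oo] --> (f t ^+ k)%:E}.
    have [A [mA A0 sA]] := phicvg; exists A; split => //.
    apply: subset_trans sA => t; apply: contra_not => h t01; have {}h := h t01.
    apply: cvg_EFin; first exact: nearW.
    have h' : Q (psi n) t @[n --> \oo] --> f t.
      by apply: cvg_comp h; exact: cvg_addnr.
    have cX j : Q (psi n) t ^+ j @[n --> \oo] --> f t ^+ j.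
      elim: j => [|j IH]; first by rewrite expr0; under eq_fun do rewrite expr0; exact: cvg_cst.
      by rewrite exprS; under eq_fun do rewrite exprS; exact: cvgM.
    exact: cX.
  have ig : mu.-integrable `]0, 1[ (fun t => (2 * (C + 1) * edge_bound t)%:E).
    exact: (@integrableZl _ _ _ mu _ (measurable_itv _) (2 * (C + 1)) _ (@integrable_edge_bound R)).
  have domae : {ae mu, forall t n, `]0, 1[%classic t ->
      (`|(Q (psi n) t ^+ k)%:E| <= (2 * (C + 1) * edge_bound t)%:E)%E}.
    by apply: aeW => t n; exact: dom.
  have [fi _ cv] := @dominated_convergence _ _ _ mu _ (measurable_itv _) _ _ _ mQ mfk cvk ig domae.
  split => //.
  have cv2 : (\int[mu]_(t in `]0%R, 1%R[) (Q (psi n) t ^+ k)%:E)%E @[n --> \oo] --> (m k)%:E.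
    under eq_fun do rewrite QM.
    apply: cvg_EFin; first exact: nearW.
    apply/cvgrPdist_le => eps eps0; have small := near_infty_natSinv_lt (PosNum eps0).
    near=> n.
    rewrite distrC; apply: le_trans (Mm _ _ _) _; first by have := psi_ge n; lia.
    apply: (@le_trans _ _ n.+1%:R^-1).
      by rewrite lef_pV2 ?posrE// ler_nat ltnS; have := psi_ge n; lia.
    by apply: ltW; near: n; exact: small.
  exact: cvg_unique cv cv2.
by apply: (@pushforward_moments _ f) => // k; have [] := key k.
Unshelve. all: by end_near. Qed.

Lemma limit_of_atomic_moments (R : realType) (m : nat -> R) :
  (forall n, exists N (w x : 'I_N -> R), [/\ forall i, 0 <= w i, \sum_i w i = 1,
     forall i j : 'I_N, (i <= j)%N -> x i <= x j &
     forall k, (k < n)%N -> `|\sum_i w i * x i ^+ k - m k| <= n.+1%:R^-1]) ->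
  exists P : probability R R,
    (forall k, P.-integrable [set: R] (fun x => (x ^+ k)%:E)) /\
    (forall k, (\int[P]_x (x ^+ k)%:E)%E = (m k)%:E).
Proof.
move=> h; have /choice[QM QMP] n : exists QM : (R -> R) * (nat -> R),
    [/\ {in `]0, 1[ &, {homo QM.1 : s t / s <= t}},
    (forall k, \int[@lebesgue_measure R]_(t in `]0%R, 1%R[) (QM.1 t ^+ k)%:E = (QM.2 k)%:E)%E &
    (forall k, (k < n)%N -> `|QM.2 k - m k| <= n.+1%:R^-1)].
  have [N [w [x [w0 w1 xm wx]]]] := h n.
  exists (quantile w x, fun k => \sum_i w i * x i ^+ k); split => //=.
    move=> s t; rewrite !in_itv/= => /andP[s0 s1] /andP[t0 t1] st.
    by apply: quantile_le => //; exact: ltW.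
  by move=> k; exact: integral_quantileX.
apply: (@limit_of_monotone_moments _ m (fun n => (QM n).1) (fun n => (QM n).2)).
- by move=> n; have [] := QMP n.
- by move=> n; have [] := QMP n.
- by move=> n; have [] := QMP n.
Qed.

(* The points decrease with the index, whence the reversal. *)
Lemma PP_moment_rev (R : realType) (N : nat) (q : R) (l : {ffun 'I_N -> int}) k : PP_moment q l k =
  \sum_(i < N) N%:R^-1 * PP_weight q l (rev_ord i) * PP_point R l (rev_ord i) ^+ k.
Proof.
rewrite /PP_moment mulr_sumr (reindex_inj rev_ord_inj)/=.
by apply: eq_bigr => i _; rewrite mulrA.
Qed.

Lemma limit_PP_moments (R : realType) (rho : forall N : nat, {ffun 'I_N -> int} -> R)
    (q : R) (mq : nat -> R) : (forall N, prob_weights (@rho N)) ->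
  -1 <= q <= 1 -> q != 0 -> moments_cvg_in_prob rho q mq ->
  exists P : probability R R,
    (forall k, P.-integrable [set: R] (fun x => (x ^+ k)%:E)) /\
    (forall k, (\int[P]_x (x ^+ k)%:E)%E = (mq k)%:E).
Proof.
move=> rhoP q1 q0 cvgq; apply: limit_of_atomic_moments => n.
have [N [l [N0 ls lk]]] := good_signature rhoP n cvgq.
exists N, (fun i => N%:R^-1 * PP_weight q l (rev_ord i)), (fun i => PP_point R l (rev_ord i)).
split.
- by move=> i; rewrite mulr_ge0 ?invr_ge0// PP_weight_ge0.
- transitivity (PP_moment q l 0); last exact: PP_moment_0.
  rewrite PP_moment_rev.
  by apply: eq_bigr => i _; rewrite expr0 mulr1.
- by move=> i j ij; apply: PP_point_le => //=; apply: leq_sub2l.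
- by move=> k kn; rewrite -PP_moment_rev lk.
Qed.

(** * The case q = 0 and the conclusion *)

Section UnitMass.
Variables (R : realType) (mu : {measure set R -> \bar R}).
Hypothesis mu1 : mu [set: R] = 1%E.

(** An alias carrying the proof of unit mass, on which the probability structure can be declared. *)
Definition unit_mass_measure of mu [set: R] = 1%E : set R -> \bar R := mu.
Local Notation P := (unit_mass_measure mu1).
HB.instance Definition _ := Measure.copy P mu.
HB.instance Definition _ := Measure_isProbability.Build _ _ _ P mu1.
Definition unit_mass_probability : probability R R := P.

End UnitMass.

Theorem theorem26 (R : realType) (rho : forall N : nat, {ffun 'I_N -> int} -> R)
  (mu0 : {measure set R -> \bar R}) (m0 : nat -> R) :
  (forall N : nat, prob_weights (rho N)) ->
  (forall k : nat, mu0.-integrable [set: R] (fun x => (x ^+ k)%:E)) ->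
  (forall k : nat, (\int[mu0]_x (x ^+ k)%:E)%E = (m0 k)%:E) ->
  moments_cvg_in_prob rho 0 m0 ->
  forall q : R, -1 <= q <= 1 ->
  exists (P : probability R R) (mq : nat -> R),
    [/\ (forall k : nat, P.-integrable [set: R] (fun x => (x ^+ k)%:E)),
        (forall k : nat, (\int[P]_x (x ^+ k)%:E)%E = (mq k)%:E),
        moments_cvg_in_prob rho q mq &
        fps_exp (fun n => if n is k.+1 then - q * m0 k else 0)
        = (fun n => if n is k.+1 then - q * mq k else 1)].
Proof.
move=> rhoP int0 mom0 cvg0 q q1.
(* For [q] nonzero the limits are, up to the factor [- q^-1], coefficients of the exponential, which
   gives the identity at once. For [q = 0] the identity reads [1 = 1], and [mu0] itself is the
   limit. *)
have [q0|q0] := eqVneq q 0; last first.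
  have cvgq := PP_moments_cvg rhoP cvg0 q0.
  have [P [Pint Pmom]] := limit_PP_moments rhoP q1 q0 cvgq.
  exists P; eexists; split; [exact: Pint|exact: Pmom|exact: cvgq|].
  apply/funext => -[|n]; first exact: fps_exp0.
  by rewrite mulrA mulrNN divff// mul1r.
(* The total mass of [mu0] is its zeroth moment, which the convergence forces to be 1. *)
have mu01 : mu0 [set: R] = 1%E.
  have := mom0 0%N; rewrite (moment0_limit rhoP cvg0) => <-.
  under eq_integral do rewrite expr0.
  by rewrite integral_cst// mul1e.
exists (unit_mass_probability mu01), m0; split; [exact: int0|exact: mom0|by rewrite q0|].
apply/funext => -[|n]; first exact: fps_exp0.
rewrite fps_expS_rec big1 ?q0 ?mulr0 ?oppr0 ?mul0r// => j _.
by rewrite mul0r mulr0 mul0r.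
Qed.
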